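(* (Rodrigues formula.) Let $k\in\mathbb{N}$, let $H_k\in\mathcal{H}_k$ be a Dunkl-harmonic of degree $k$, and let $t$ be a positive integer. Then the Clifford--Hermite polynomial $C\!H_{2t}^{\mu}(H_k)=(D_+)^{2t}H_k$ satisfies \[ C\!H_{2t}^{\mu}(H_k) = \exp(|x|^2/2)\,\big(-\Delta_{\kappa} - |x|^2 + 2\mathbb{E} + \mu\big)^{t}\,\big(\exp(-|x|^2/2)\, H_k\big) = \exp(|x|^2)\,(-\Delta_{\kappa})^t\,\big(\exp(-|x|^2)\, H_k\big). \]
   Context: Let $R\subset\mathbb{R}^m$ be a reduced root system normalized so that $\langle\alpha,\alpha\rangle=2$ for all $\alpha\in R$, with positive subsystem $R_+$, and let $G\subset O(m)$ be the finite reflection group generated by the reflections $r_\alpha(x)=x-2\frac{\langle\alpha,x\rangle}{|\alpha|^2}\alpha$, $\alpha\in R$. Let $\kappa:R\to\mathbb{C}$ be a $G$-invariant multiplicity function, $\kappa_\alpha=\kappa(\alpha)$. The Dunkl operators are $T_i f(x)=\partial_{x_i}f(x)+\sum_{\alpha\in R_+}\kappa_\alpha\alpha_i\frac{f(x)-f(r_\alpha x)}{\langle\alpha,x\rangle}$, $i=1,\dots,m$; they commute. The Dunkl Laplacian is $\Delta_\kappa=\sum_{i=1}^m T_i^2$. Put $\gamma=\sum_{\alpha\in R_+}\kappa_\alpha$ and $\mu=m+2\gamma$ (the Dunkl dimension). $\mathbb{E}=\sum_{i=1}^m x_i\partial_{x_i}$ is the Euler operator. $\mathcal{P}_k$ denotes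 real homogeneous polynomials of degree $k$ on $\mathbb{R}^m$ and $\mathcal{H}_k=\mathcal{P}_k\cap\ker\Delta_\kappa$ the Dunkl-harmonics of degree $k$. Let $\mathcal{C}l_{0,m}$ be the Clifford algebra generated by $e_1,\dots,e_m$ with $e_ie_j+e_je_i=-2\delta_{ij}$. Set $\underline{x}=\sum_i e_ix_i$, the Dunkl Dirac operator $D_\kappa=\sum_i e_iT_i$, and $D_+=-D_\kappa+2\underline{x}$, acting on $\mathcal{C}l_{0,m}$-valued polynomials. The Clifford--Hermite polynomial of degree $2t$ associated with $H_k\in\mathcal{H}_k$ is $C\!H_{2t}^{\mu}(H_k)=(D_+)^{2t}H_k$ (a scalar polynomial, since $D_+^2=-\Delta_\kappa-4|x|^2+2(2\mathbb{E}+\mu)$). *)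

(* Defs.v *)
From HB Require Import structures.
From mathcomp Require Import all_boot all_order all_algebra.
From mathcomp Require Import all_classical all_reals all_analysis.
From mathcomp Require Import complex.

Set Implicit Arguments.
Unset Strict Implicit.
Unset Printing Implicit Defensive.

Import Order.TTheory GRing.Theory Num.Theory.
Local Open Scope ring_scope.
Local Open Scope complex_scope.

Section Dunkl.
Variables (R : realType) (m : nat).

Notation vec := 'rV[R]_m.
Notation C := R[i].

Definition dotp (u v : vec) : R := \sum_(i < m) u 0 i * v 0 i.
Definition sqnorm (x : vec) : R := dotp x x.

Definition refl (a x : vec) : vec := x - (2 * dotp a x / dotp a a) *: a.

Definition root_system (Rs : seq vec) : Prop :=
  [/\ uniq Rs,
      (forall a, a \in Rs -> a != 0),
      (forall a b, a \in Rs -> b \in Rs -> refl a b \in Rs) &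
      (forall a (c : R), a \in Rs -> c *: a \in Rs -> c = 1 \/ c = -1)].

Definition normalized (Rs : seq vec) : Prop :=
  forall a, a \in Rs -> dotp a a = 2.

Definition positive_subsystem (Rs Rp : seq vec) : Prop :=
  uniq Rp /\
  exists beta : vec, (forall a, a \in Rs -> dotp beta a != 0) /\
    (forall a, a \in Rp <-> (a \in Rs /\ 0 < dotp beta a)).

(** G-invariance of the multiplicity function: invariant under every element
    of the group G generated by the reflections r_b, b in R (every element of
    G is a finite product of such reflections, which are involutions). *)
Definition G_invariant (Rs : seq vec) (kappa : vec -> C) : Prop :=
  forall (s : seq vec) (a : vec), all (mem Rs) s -> a \in Rs ->
    kappa (foldr refl a s) = kappa a.

(** The Clifford algebra Cl_{0,m} (complexified, since kappa is complex):
    elements are coordinate families over the basis blades e_A, A subset of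
    {0..m-1}, e_A = e_{i1} ... e_{ij} with i1 < ... < ij. *)
Definition Cl := {ffun {set 'I_m} -> C}.

Definition blade (A : {set 'I_m}) : Cl := [ffun B => (B == A)%:R].

(* e_A e_B = sign(A,B) e_{A Delta B}, with e_i e_j = - e_j e_i (i <> j)
   and e_i^2 = -1 *)
Definition blade_sign (A B : {set 'I_m}) : C :=
  (-1) ^+ (#|[set p : 'I_m * 'I_m | (p.1 \in A) && (p.2 \in B) && (p.2 < p.1)%N]|
           + #|A :&: B|).

Definition clmul (u v : Cl) : Cl :=
  \sum_(A : {set 'I_m}) \sum_(B : {set 'I_m})
     (blade_sign A B * u A * v B) *: blade ((A :\: B) :|: (B :\: A)).

Definition cle (i : 'I_m) : Cl := blade [set i].

Definition clsc (c : C) : Cl := c *: blade (@finset.set0 _).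

Definition clfun := vec -> Cl.

Definition ddir (v : vec) (F : clfun) : clfun := fun x =>
  [ffun A => (derive (fun y => complex.Re (F y A)) x v) +i* (derive (fun y => complex.Im (F y A)) x v)].

Definition unitv (i : 'I_m) : vec := delta_mx 0 i.

Definition partial (i : 'I_m) (F : clfun) : clfun := ddir (unitv i) F.

(* (F(x) - F(r_a x)) / <a,x>, extended by continuity to the hyperplane
   <a,x> = 0 (where its value is the directional derivative along a,
   since r_a x = x - <a,x> a when |a|^2 = 2). *)
Definition dquot (a : vec) (F : clfun) : clfun := fun x =>
  if dotp a x == 0 then ddir a F x
  else ((dotp a x)^-1)%:C *: (F x - F (refl a x)).

Definition dunkl (Rp : seq vec) (kappa : vec -> C) (i : 'I_m) (F : clfun) : clfun :=
  fun x => partial i F x + \sum_(a <- Rp) (kappa a * (a 0 i)%:C) *: dquot a F x.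

Definition dunkl_lap (Rp : seq vec) (kappa : vec -> C) (F : clfun) : clfun :=
  fun x => \sum_(i < m) dunkl Rp kappa i (dunkl Rp kappa i F) x.

Definition dunkl_dirac (Rp : seq vec) (kappa : vec -> C) (F : clfun) : clfun :=
  fun x => \sum_(i < m) clmul (cle i) (dunkl Rp kappa i F x).

Definition xmul (F : clfun) : clfun :=
  fun x => \sum_(i < m) (x 0 i)%:C *: clmul (cle i) (F x).

Definition euler (F : clfun) : clfun :=
  fun x => \sum_(i < m) (x 0 i)%:C *: partial i F x.

Definition Dplus (Rp : seq vec) (kappa : vec -> C) (F : clfun) : clfun :=
  fun x => - dunkl_dirac Rp kappa F x + 2%:R *: xmul F x.

Definition gamma (Rp : seq vec) (kappa : vec -> C) : C := \sum_(a <- Rp) kappa a.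
Definition mu (Rp : seq vec) (kappa : vec -> C) : C := m%:R + 2%:R * gamma Rp kappa.

Definition of_real (f : vec -> R) : clfun := fun x => clsc (f x)%:C.

Definition hom_poly (k : nat) (f : vec -> R) : Prop :=
  exists c : {ffun 'I_m -> 'I_k.+1} -> R,
    forall x : vec, f x = \sum_(e : {ffun 'I_m -> 'I_k.+1} | (\sum_(i < m) (e i : nat) == k)%N)
                            c e * \prod_(i < m) x 0 i ^+ e i.

Definition dunkl_harmonic (Rp : seq vec) (kappa : vec -> C) (k : nat) (f : vec -> R) : Prop :=
  hom_poly k f /\ dunkl_lap Rp kappa (of_real f) = (fun _ => 0).

Definition clifford_hermite (Rp : seq vec) (kappa : vec -> C) (t : nat) (H : vec -> R) : clfun :=
  iter t.*2 (Dplus Rp kappa) (of_real H).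

Definition Lop (Rp : seq vec) (kappa : vec -> C) (F : clfun) : clfun :=
  fun x => - dunkl_lap Rp kappa F x - (sqnorm x)%:C *: F x + 2%:R *: euler F x
           + mu Rp kappa *: F x.

Definition rmul (g : vec -> R) (F : clfun) : clfun := fun x => (g x)%:C *: F x.

End Dunkl.

(* Main.v *)
Require Import Defs.
From HB Require Import structures.
From mathcomp Require Import all_boot all_order all_algebra.
From mathcomp Require Import all_classical all_reals all_analysis.
From mathcomp Require Import complex.
From mathcomp Require Import ring.
Import Order.TTheory GRing.Theory Num.Theory.
Local Open Scope ring_scope.
Local Open Scope complex_scope.
Import numFieldNormedType.Exports.

(* On Clifford-valued polynomials the Dunkl operators satisfy
   T_v(<u,x> F) = <u,x> T_v F + <u,v> F + sum_a kappa_a <a,v> <a,u> F(r_a x);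
   together with additivity and T_v(const) = 0 this rule determines them, so the
   equivariance r_b T_v = T_{r_b v} r_b and then the commutation [T_v, T_w] = 0
   follow by induction on the construction of polynomials, without looking at
   the divided differences again.  For a fixed real c the operators
   S_i = T_i - c x_i then commute as well.  As D_+ = - sum_i e_i S_i with c = 2
   and the e_i anticommute, D_+^2 = - sum_i S_i^2 for c = 2.  Conjugating T_i by
   exp(-c|x|^2/2) produces S_i, which identifies this operator with the
   conjugates of the Dunkl Laplacian (c = 2) and of the operator
   -Delta - |x|^2 + 2E + mu (c = 1). *)

Set Implicit Arguments.
Unset Strict Implicit.
Unset Printing Implicit Defensive.

(** * Left multiplication by the generators of the Clifford algebra *)

Section Clifford.
Variables (R : realType) (m : nat).
Local Notation C := R[i].
Local Notation Cl := (Cl R m).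

(** The symmetric difference with {i}, spelled as the index of the product blade in [clmul], so that
    e_i e_B is e_([toggle i B]) up to sign. *)
Definition toggle (i : 'I_m) (B : {set 'I_m}) : {set 'I_m} :=
  ([set i] :\: B) :|: (B :\: [set i]).

Lemma in_toggle (i b : 'I_m) (B : {set 'I_m}) :
  (b \in toggle i B) = (b == i) (+) (b \in B).
Proof. by rewrite !inE; case: (b == i); case: (b \in B). Qed.

Lemma toggleK (i : 'I_m) : involutive (toggle i).
Proof. by move=> B; apply/setP=> b; rewrite !in_toggle addbA addbb. Qed.

Lemma toggleC (i j : 'I_m) (B : {set 'I_m}) :
  toggle i (toggle j B) = toggle j (toggle i B).
Proof. by apply/setP=> b; rewrite !in_toggle addbCA. Qed.

(** The sign of e_i e_B: each b < i in B costs one transposition, and b = i contributes e_i^2 = -1,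
    hence the non-strict inequality. *)
Definition gen_sign (i : 'I_m) (B : {set 'I_m}) : C :=
  \prod_(b | b \in B) (-1) ^+ (b <= i)%N.

Lemma blade_sign1 (i : 'I_m) (B : {set 'I_m}) :
  blade_sign R [set i] B = gen_sign i B.
Proof.
rewrite /blade_sign /gen_sign prodrXr; congr (_ ^+ _).
rewrite (bigID (pred1 i)) /= addnC; congr addn.
  rewrite -sum1_card big_mkcond [RHS]big_mkcond; apply: eq_bigr => b _.
  by rewrite !inE andbC; case: eqP => [->|]; rewrite ?leqnn andbC //=; case: (_ \in B).
(* The inversions between {i} and B are the pairs (i, b) with b in B and b < i. *)
rewrite -sum1_card (reindex_onto (fun b => (i, b)) snd) /=; last first.
  by move=> [a b]; rewrite !inE /= => /andP [/andP [/eqP ->]].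
rewrite big_mkcond [RHS]big_mkcond; apply: eq_bigr => b _.
rewrite !inE /= !eqxx andbT /= ltn_neqAle -(inj_eq val_inj).
by case: (b \in B); case: (val b == val i); case: (b <= i)%N.
Qed.

(** Only the factor of j appears or disappears; as it is its own inverse, insertion and removal have
    the same effect. *)
Lemma gen_sign_toggle (i j : 'I_m) (B : {set 'I_m}) :
  gen_sign i (toggle j B) = (-1) ^+ (j <= i)%N * gen_sign i B.
Proof.
rewrite /gen_sign big_mkcond [in RHS]big_mkcond (bigD1 j) //=.
rewrite [in RHS](bigD1 j) //= mulrA; congr (_ * _); last first.
  by apply: eq_bigr => b bj; rewrite in_toggle (negPf bj).
rewrite in_toggle eqxx /=; case: (j \in B); rewrite /= ?mulr1 //.
by rewrite -expr2 sqrr_sign.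
Qed.

(** Since [toggle i] is an involution, only the blade [toggle i A] of v contributes to the
    coefficient of e_A in e_i v. *)
Lemma clmul_cleE (i : 'I_m) (v : Cl) (A : {set 'I_m}) :
  clmul (cle R i) v A = gen_sign i (toggle i A) * v (toggle i A).
Proof.
rewrite /clmul sum_ffunE (bigD1 [set i]) //= [X in _ + X]big1 ?addr0; last first.
  move=> B Bi; rewrite sum_ffunE big1 // => D _.
  by rewrite !ffunE (negPf Bi) mulr0 mul0r scale0r.
rewrite sum_ffunE (bigD1 (toggle i A)) //= [X in _ + X]big1 ?addr0; last first.
  move=> B Bi; rewrite !ffunE eqxx -/(toggle i B) mulr1.
  case: eqP => [AB|]; last by rewrite scaler0.
  by move: Bi; rewrite AB toggleK eqxx.
by rewrite !ffunE eqxx -/(toggle i _) toggleK eqxx blade_sign1 !mulr1 /GRing.scale /= mulr1.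
Qed.

Lemma clmul_cleD (i : 'I_m) : {morph clmul (cle R i) : u v / u + v}.
Proof. by move=> u v; apply/ffunP=> A; rewrite !(clmul_cleE, ffunE) mulrDr. Qed.

Lemma clmul_cleZ (i : 'I_m) (c : C) : {morph clmul (cle R i) : u / c *: u}.
Proof. by move=> u; apply/ffunP=> A; rewrite !(clmul_cleE, ffunE) mulrCA. Qed.

Lemma clmul_cle_sqr (i : 'I_m) (v : Cl) :
  clmul (cle R i) (clmul (cle R i) v) = - v.
Proof.
apply/ffunP=> A; rewrite !(clmul_cleE, ffunE) toggleK gen_sign_toggle leqnn.
rewrite expr1 mulN1r mulNr mulrA /gen_sign -big_split /= big1 ?mul1r //.
by move=> b _; rewrite -expr2 sqrr_sign.
Qed.

Lemma clmul_cle_anti (i j : 'I_m) (v : Cl) : i != j ->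
  clmul (cle R i) (clmul (cle R j) v) = - clmul (cle R j) (clmul (cle R i) v).
Proof.
move=> ij; apply/ffunP=> A; rewrite !(clmul_cleE, ffunE) toggleC !mulrA -mulNr.
congr (_ * _); rewrite !gen_sign_toggle !leqnn.
(* For i != j exactly one of the two orders holds, so the two products differ by exactly one
   sign. *)
have: (j <= i)%N = ~~ (i <= j)%N.
  by rewrite -ltnNge ltn_neqAle eq_sym -(inj_eq val_inj) in ij *; rewrite ij.
by move=> ->; case: (i <= j)%N => /=; ring.
Qed.

(* Commuting operators combined with anticommuting generators: the cross terms
   cancel in pairs. *)
Lemma clmul_cle_sum2 (w : 'I_m -> 'I_m -> Cl) : (forall i j, w i j = w j i) ->
  \sum_i \sum_j clmul (cle R i) (clmul (cle R j) (w i j)) = - \sum_i w i i.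
Proof.
(* The diagonal correction compensates e_i^2 = -1 and makes f antisymmetric on the diagonal as well,
   so that its double sum vanishes. *)
move=> wC; pose f i j := clmul (cle R i) (clmul (cle R j) (w i j)) + (i == j)%:R *: w i j.
have f_anti i j : f i j = - f j i.
  rewrite /f eq_sym; have [->|ji] := eqVneq j i.
    by rewrite clmul_cle_sqr scale1r addNr oppr0.
  by rewrite !scale0r !addr0 (wC i j); apply: clmul_cle_anti; rewrite eq_sym.
have f0 : \sum_i \sum_j f i j = 0.
  have : \sum_i \sum_j f i j = - \sum_i \sum_j f i j.
    rewrite {1}exchange_big -sumrN; apply: eq_bigr => i _.
    by rewrite -sumrN; apply: eq_bigr => j _.
  move/eqP; rewrite -addr_eq0 -mulr2n -scaler_nat scaler_eq0 pnatr_eq0 /=.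
  by move/eqP.
apply/eqP; rewrite -addr_eq0 -[eqbRHS]f0 -big_split /=; apply/eqP.
apply: eq_bigr => i _; rewrite big_split /=; congr (_ + _).
rewrite (bigD1 i) //= eqxx scale1r big1 ?addr0 // => j ji.
by rewrite eq_sym (negPf ji) scale0r.
Qed.

End Clifford.

(** * The scalar product and reflections in vectors of squared length 2 *)

Section DotProduct.
Variables (R : realType) (m : nat).
Local Notation vec := 'rV[R]_m.

Lemma dotpC (u v : vec) : dotp u v = dotp v u.
Proof. by apply: eq_bigr => i _; rewrite mulrC. Qed.

Lemma dotpDr (u v w : vec) : dotp u (v + w) = dotp u v + dotp u w.
Proof. by rewrite /dotp -big_split; apply: eq_bigr => i _; rewrite mxE mulrDr. Qed.

Lemma dotpZr (c : R) (u v : vec) : dotp u (c *: v) = c * dotp u v.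
Proof. by rewrite /dotp mulr_sumr; apply: eq_bigr => i _; rewrite mxE mulrCA. Qed.

Lemma dotpNr (u v : vec) : dotp u (- v) = - dotp u v.
Proof. by rewrite -scaleN1r dotpZr mulN1r. Qed.

Lemma dotpBr (u v w : vec) : dotp u (v - w) = dotp u v - dotp u w.
Proof. by rewrite dotpDr dotpNr. Qed.

Lemma dotpNl (u v : vec) : dotp (- u) v = - dotp u v.
Proof. by rewrite dotpC dotpNr dotpC. Qed.

Lemma dotp_unitv (i : 'I_m) (v : vec) : dotp (unitv R i) v = v 0 i.
Proof.
rewrite /dotp (bigD1 i) //= big1 ?addr0; first by rewrite mxE !eqxx mul1r.
by move=> j ji; rewrite mxE (negPf ji) andbF mul0r.
Qed.

Lemma refl2E (a x : vec) : dotp a a = 2 -> refl a x = x - dotp a x *: a.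
Proof. by move=> a2; rewrite /refl a2 mulrAC divff ?mul1r // pnatr_eq0. Qed.

Lemma refl_fix (a x : vec) : dotp a x = 0 -> refl a x = x.
Proof. by move=> ax; rewrite /refl ax mulr0 mul0r scale0r subr0. Qed.

Lemma refl_Nroot (a x : vec) : refl (- a) x = refl a x.
Proof. by rewrite /refl !dotpNl dotpNr opprK mulrN mulNr scalerN scaleNr opprK. Qed.

Lemma dotp_refl (a x y : vec) : dotp a a = 2 ->
  dotp (refl a x) y = dotp x (refl a y).
Proof.
move=> a2; rewrite !refl2E // dotpC !dotpBr !dotpZr.
by rewrite (dotpC y x) (dotpC y a) (dotpC x a); ring.
Qed.

Lemma reflK (a : vec) : dotp a a = 2 -> involutive (refl a).
Proof.
move=> a2 x; rewrite !(refl2E _ a2) dotpBr dotpZr a2.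
by apply/rowP => i; rewrite !mxE; ring.
Qed.

Lemma refl_isom (a x y : vec) : dotp a a = 2 ->
  dotp (refl a x) (refl a y) = dotp x y.
Proof. by move=> a2; rewrite dotp_refl // reflK. Qed.

Lemma refl_self (a : vec) : dotp a a = 2 -> refl a a = - a.
Proof. by move=> a2; rewrite refl2E // a2 scaler_nat mulr2n opprD addNKr. Qed.

Lemma refl_oppr (a x : vec) : dotp a a = 2 -> refl a (- x) = - refl a x.
Proof. by move=> a2; rewrite !refl2E // dotpNr scaleNr opprD. Qed.

(** The conjugation rule r_b r_a r_b = r_(r_b a), arranged for moving r_b past a sum over roots. *)
Lemma refl_conj (a b x : vec) : dotp a a = 2 -> dotp b b = 2 ->
  refl a (refl b x) = refl b (refl (refl b a) x).
Proof.
move=> a2 b2; have c2 : dotp (refl b a) (refl b a) = 2 by rewrite refl_isom.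
rewrite (refl2E x c2) (refl2E _ a2) !(refl2E _ b2) !dotpBr !dotpZr.
rewrite ![dotp (_ - _) x]dotpC !dotpBr !dotpZr b2 (dotpC b a) !(dotpC x).
by apply/rowP => i; rewrite !mxE; ring.
Qed.

End DotProduct.

(** * Directional derivatives of linear forms, of |x|^2 and of Gaussians *)

Section Derivatives.
Variables (R : realType) (m : nat).
Local Notation vec := 'rV[R]_m.

Lemma is_derive_dotp (u x v : vec) :
  is_derive x v (fun y => dotp u y : R) (dotp u v).
Proof.
have cv : ((fun h : R => h^-1 *: (((dotp u : vec -> R) \o shift x) (h *: v) - dotp u x))
    @ 0^' --> (dotp u v : R))%classic.
  (* The difference quotient of a linear form is constant for h != 0. *)
  apply: cvg_near_cst; near=> h.
  rewrite /= dotpDr addrK dotpZr /GRing.scale /= mulrA mulVf ?mul1r //.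
  by near: h; exact: nbhs_dnbhs_neq.
apply: DeriveDef; first by apply/cvg_ex; exists (dotp u v).
by rewrite /derive; apply: cvg_lim cv.
Unshelve. all: by end_near. Qed.

Lemma differentiable_sqnorm (x : vec) : differentiable (@sqnorm R m : vec -> R) x.
Proof.
rewrite (_ : @sqnorm R m = \sum_(i < m) ((fun y : vec => y 0 i) * (fun y : vec => y 0 i))).
  apply: differentiable_sum => i; apply: differentiableM; exact: differentiable_coord.
by apply/funext => y; rewrite fct_sumE.
Qed.

Lemma is_derive_sqnorm (x v : vec) :
  is_derive x v (@sqnorm R m : vec -> R) (2 * dotp x v).
Proof.
have -> : (@sqnorm R m) = \sum_(i < m) ((dotp (unitv R i)) * (dotp (unitv R i))).
  apply/funext => y; rewrite fct_sumE; apply: eq_bigr => i _.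
  by rewrite /= !fctE dotp_unitv.
apply: is_derive_eq.
  apply: is_derive_sum => i; apply: is_deriveM; exact: is_derive_dotp.
rewrite /dotp mulr_sumr; apply: eq_bigr => i _.
by rewrite -!/(dotp _ _) !dotp_unitv /GRing.scale /=; ring.
Qed.

Lemma is_derive_gaussian (c : R) (x v : vec) :
  is_derive x v (fun y : vec => expR (- (c * sqnorm y)))
    (- (2 * c * dotp x v) * expR (- (c * sqnorm x))).
Proof.
(* The chain rule is applied to differentials, from which the directional derivative is then read
   off. *)
have dq : differentiable (fun y : vec => - (c * sqnorm y)) x.
  apply: differentiableN; apply: differentiableZ; exact: differentiable_sqnorm.
have de y : differentiable (@expR R) y by apply/derivable1_diffP; exact: derivable_expR.
have dc : differentiable (@expR R \o (fun y : vec => - (c * sqnorm y))) x.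
  exact: differentiable_comp.
apply: DeriveDef; first exact: diff_derivable.
rewrite (_ : (fun y => _) = @expR R \o (fun y : vec => - (c * sqnorm y))) //.
rewrite (deriveE _ dc) diff_comp // /= -(deriveE _ dq).
rewrite diff1E // derive1E derive_val.
have -> : 'D_v (fun y : vec => - (c * sqnorm y)) x = - (c * (2 * dotp x v)).
  by have /@derive_val := is_deriveN (is_deriveZ c (is_derive_sqnorm x v)).
by rewrite /GRing.scale /=; ring.
Qed.

End Derivatives.

(** * Derivatives of Clifford-valued functions, and Clifford-valued polynomials *)

Section DirectionalDerivative.
Variables (R : realType) (m : nat).
Local Notation vec := 'rV[R]_m.
Local Notation C := R[i].
Local Notation Cl := (Cl R m).
Local Notation clfun := (clfun R m).
Implicit Types (F G : clfun) (v x : vec).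

Definition derivable_cl F := forall x v A,
  derivable (fun y : vec => complex.Re (F y A) : R) x v /\
  derivable (fun y : vec => complex.Im (F y A) : R) x v.

Lemma ddir_cst (c : Cl) v x : ddir v (fun=> c) x = 0.
Proof.
apply/ffunP => A; rewrite !ffunE.
by rewrite (@derive_cst _ _ R^o (complex.Re (c A))) (@derive_cst _ _ R^o (complex.Im (c A))).
Qed.

Lemma derivable_clD F G : derivable_cl F -> derivable_cl G ->
  derivable_cl (fun x => F x + G x).
Proof.
move=> dF dG x v A; have [F1 F2] := dF x v A; have [G1 G2] := dG x v A.
rewrite (_ : (fun y => complex.Re _) =
  (fun y => complex.Re (F y A)) + (fun y => complex.Re (G y A))); last first.
  by apply/funext => y; rewrite ffunE raddfD.
rewrite (_ : (fun y => complex.Im _) =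
  (fun y => complex.Im (F y A)) + (fun y => complex.Im (G y A))); last first.
  by apply/funext => y; rewrite ffunE raddfD.
by split; apply: derivableD.
Qed.

Lemma ddirD F G v x : derivable_cl F -> derivable_cl G ->
  ddir v (fun y => F y + G y) x = ddir v F x + ddir v G x.
Proof.
move=> dF dG; apply/ffunP => A; rewrite !ffunE.
have [F1 F2] := dF x v A; have [G1 G2] := dG x v A.
rewrite (_ : (fun y => complex.Re _) =
  (fun y => complex.Re (F y A)) + (fun y => complex.Re (G y A))); last first.
  by apply/funext => y; rewrite ffunE raddfD.
rewrite (_ : (fun y => complex.Im _) =
  (fun y => complex.Im (F y A)) + (fun y => complex.Im (G y A))); last first.
  by apply/funext => y; rewrite ffunE raddfD.
by rewrite !deriveD.
Qed.

Lemma Re_rmul (g : R) (z : C) : complex.Re (g%:C * z) = g * complex.Re z.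
Proof. by case: z => a b /=; rewrite mul0r subr0. Qed.

Lemma Im_rmul (g : R) (z : C) : complex.Im (g%:C * z) = g * complex.Im z.
Proof. by case: z => a b /=; rewrite mul0r addr0. Qed.

Lemma rmul_ReIm (g : vec -> R) F A :
  ((fun y => complex.Re (rmul g F y A)) = g * (fun y => complex.Re (F y A))) *
  ((fun y => complex.Im (rmul g F y A)) = g * (fun y => complex.Im (F y A))).
Proof. by split; apply/funext => y; rewrite ffunE ?Re_rmul ?Im_rmul. Qed.

Lemma derivable_rmul (g : vec -> R) (dg : vec -> vec -> R) F :
  (forall x v, is_derive x v g (dg x v)) -> derivable_cl F ->
  derivable_cl (rmul g F).
Proof.
move=> g' dF x v A; have [F1 F2] := dF x v A; rewrite !rmul_ReIm.
have g1 : derivable g x v := @ex_derive _ _ _ _ _ _ _ (g' x v).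
by split; [exact: (derivableM g1 F1)|exact: (derivableM g1 F2)].
Qed.

Lemma ddir_rmul (g : vec -> R) (dg : R) F v x :
  is_derive x v g dg -> derivable_cl F ->
  ddir v (rmul g F) x = dg%:C *: F x + (g x)%:C *: ddir v F x.
Proof.
move=> g' dF; apply/ffunP => A; rewrite !ffunE !rmul_ReIm.
have [F1 F2] := dF x v A; have g1 : derivable g x v := @ex_derive _ _ _ _ _ _ _ g'.
rewrite (deriveM g1 F1) (deriveM g1 F2) (@derive_val _ _ _ _ _ _ _ g').
by case: (F x A) => a b; rewrite /GRing.scale /=; congr (_ +i* _); ring.
Qed.

(** The Clifford-valued polynomials. The constructors are the three cases of the inductions on Dunkl
    operators; arbitrary linear forms instead of coordinates make stability under reflections
    immediate. *)
Inductive clpoly : clfun -> Prop :=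
| clpoly_cst (c : Cl) : clpoly (fun=> c)
| clpolyD F G : clpoly F -> clpoly G -> clpoly (fun x => F x + G x)
| clpoly_dotp (u : vec) F : clpoly F -> clpoly (rmul (dotp u) F).

Lemma clpoly_derivable F : clpoly F -> derivable_cl F.
Proof.
elim=> [c x v A|{}F G _ dF _ dG|u {}F _ dF].
- by split; apply: derivable_cst.
- exact: derivable_clD.
- by apply: derivable_rmul dF => x v; exact: is_derive_dotp.
Qed.

(** Treats complex scalars, negation and left multiplication by e_i at once: such an M acts on
    values and commutes with factors <u,x>. *)
Lemma clpoly_map (M : Cl -> Cl) F : {morph M : u v / u + v} ->
  (forall c, {morph M : u / c *: u}) -> clpoly F -> clpoly (fun x => M (F x)).
Proof.
move=> MD MZ; elim=> [c|{}F G _ pF _ pG|u {}F _ pF]; first exact: clpoly_cst.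
- rewrite (_ : (fun _ => _) = fun x => M (F x) + M (G x)); first exact: clpolyD.
  by apply/funext => x; rewrite MD.
- rewrite (_ : (fun _ => _) = rmul (dotp u) (fun x => M (F x))).
    exact: clpoly_dotp.
  by apply/funext => x; rewrite MZ.
Qed.

Lemma clpolyZ (c : C) F : clpoly F -> clpoly (fun x => c *: F x).
Proof.
apply: clpoly_map => [u v|b u]; first exact: scalerDr.
by rewrite !scalerA mulrC.
Qed.

Lemma clpoly_sum (I : eqType) (s : seq I) (F : I -> clfun) :
  (forall i, i \in s -> clpoly (F i)) -> clpoly (fun x => \sum_(i <- s) F i x).
Proof.
elim: s => [|i s IHs] pF.
  rewrite (_ : (fun _ => _) = fun=> 0); first exact: clpoly_cst.
  by apply/funext => x; rewrite big_nil.
rewrite (_ : (fun _ => _) = fun x => F i x + \sum_(j <- s) F j x).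
  apply: clpolyD; first by apply: pF; rewrite mem_head.
  by apply: IHs => j js; apply: pF; rewrite in_cons js orbT.
by apply/funext => x; rewrite big_cons.
Qed.

Lemma clpoly_refl (a : vec) F : dotp a a = 2 -> clpoly F -> clpoly (F \o refl a).
Proof.
move=> a2; elim=> [c|{}F G _ pF _ pG|u {}F _ pF]; first exact: clpoly_cst.
- exact: clpolyD pF pG.
- rewrite (_ : _ \o _ = rmul (dotp (refl a u)) (F \o refl a)).
    exact: clpoly_dotp.
  by apply/funext => x; rewrite /rmul /= dotp_refl.
Qed.

Lemma clpoly_monomial k (e : 'I_m -> 'I_k) (c : R) :
  clpoly (fun x => clsc m (c * \prod_(i < m) x 0 i ^+ e i)%:C).
Proof.
have -> : (fun x => clsc m (c * \prod_(i < m) x 0 i ^+ e i)%:C) =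
    rmul (fun x : vec => \prod_(i < m) x 0 i ^+ e i) (fun=> clsc m c%:C).
  by apply/funext => x; rewrite /rmul /clsc scalerA mulrC rmorphM.
(* The monomial is built coordinate by coordinate, each power being an iterated multiplication by
   the linear form x_i. *)
elim: (index_enum _) => [|i s IHs].
  rewrite (_ : rmul _ _ = fun=> clsc m c%:C); first exact: clpoly_cst.
  by apply/funext => x; rewrite /rmul big_nil scale1r.
have -> : rmul (fun x : vec => \prod_(j <- i :: s) x 0 j ^+ e j) (fun=> clsc m c%:C) =
   iter (e i) (rmul (dotp (unitv R i)))
     (rmul (fun x : vec => \prod_(j <- s) x 0 j ^+ e j) (fun=> clsc m c%:C)).
  apply/funext => x; rewrite /rmul big_cons.
  elim: (nat_of_ord _) => [|n IHn] /=; first by rewrite expr0 mul1r.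
  by rewrite exprS -mulrA rmorphM -scalerA IHn dotp_unitv.
by elim: (nat_of_ord _) => [|n IHn] //=; exact: clpoly_dotp.
Qed.

Lemma hom_poly_clpoly k (f : vec -> R) : hom_poly k f -> clpoly (of_real f).
Proof.
move=> [c fE]; rewrite /of_real.
have -> : (fun x => clsc m (f x)%:C) = fun x =>
    \sum_(e <- enum [pred e : {ffun 'I_m -> 'I_k.+1} | (\sum_(i < m) (e i : nat) == k)%N])
      clsc m (c e * \prod_(i < m) x 0 i ^+ e i)%:C.
  by apply/funext => x; rewrite fE /clsc rmorph_sum scaler_suml big_enum.
by apply: clpoly_sum => e _; exact: clpoly_monomial.
Qed.

End DirectionalDerivative.

(** * Rearrangements of terms in a module over a commutative ring *)

Section ModuleIdentities.
Variables (K : comPzRingType) (V : lmodType K).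

Lemma addr_scaleACA (c : K) (x y z t : V) :
  x + c *: y + (z + c *: t) = x + z + c *: (y + t).
Proof. by rewrite scalerDr addrACA. Qed.

(** Splits the product rule for T_(v+cw) into the one for T_v and c times the one for T_w. *)
Lemma leibniz_linear (c p q r : K) (x y z s t : V) :
  p *: (x + c *: y) + (q + c * r) *: z + (s + c *: t) =
    p *: x + q *: z + s + c *: (p *: y + r *: z + t).
Proof.
rewrite !scalerDr scalerDl !scalerA [c * p]mulrC.
by rewrite [RHS]addrACA [X in _ = X + _]addrACA.
Qed.

(** Collects the two contributions of one root to T_v T_w (<u,x> F) into an expression symmetric in
    v and w. *)
Lemma commutator_terms (k p q r : K) (x y z : V) :
  (k * (p * r)) *: (x - q *: z) + (k * (q * r)) *: y =
    (k * r) *: (p *: x + q *: y - (p * q) *: z).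
Proof.
rewrite !scalerBr !scalerDr !scalerA addrAC.
have -> : k * (p * r) = k * r * p by rewrite [p * r]mulrC mulrA.
by rewrite !mulrA [k * q * r]mulrAC.
Qed.

(** The expansion of (T_v - c <v,x>)(T_w - c <w,x>), sorted by powers of c. *)
Lemma shifted_terms (c p r : K) (f q s t x y : V) :
  t - c *: (p *: x + q + s) - c *: (r *: (y - c *: (p *: f))) =
  t - c *: (p *: x + r *: y + (q + s)) + (c * c * (r * p)) *: f.
Proof.
have -> : c *: (r *: (y - c *: (p *: f))) = c *: (r *: y) - (c * c * (r * p)) *: f.
  rewrite !scalerBr !scalerA; congr (_ - _ *: _); ring.
rewrite opprB [_ *: f - _]addrC addrA; congr (_ + _).
rewrite -addrA -opprD -scalerDr; congr (_ - _ *: _).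
by rewrite -!addrA; congr (_ + _); rewrite [RHS]addrC -addrA.
Qed.

Lemma shifted_sum_terms (g n : K) (y f s : V) :
  y + (g *: f - s) + (y + (g *: f - s)) + (n *: f + 2%:R *: s) =
    2%:R *: y + (n + 2%:R * g) *: f.
Proof.
rewrite (scalerDl f n (2%:R * g)) -scalerA !scaler_nat -mulr2n [RHS]addrCA [LHS]addrCA.
by congr (_ + _); rewrite mulrnDl mulrnBl -addrA subrK.
Qed.

(** Here d, e, q stand for the Dunkl Laplacian of f, the Euler operator on f, and |x|^2. The terms
    -|x|^2 + 2E + mu, with E conjugated to E - |x|^2, turn the expression for c = 1 into the one for
    c = 2. *)
Lemma gaussian_terms (q : K) (d e f : V) (mu : K) :
  - (d - 1 *: (2%:R *: e + mu *: f) + (1 * 1 * q) *: f) - q *: f +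
    2%:R *: (e - q *: f) + mu *: f =
  - (d - 2%:R *: (2%:R *: e + mu *: f) + (2%:R * 2%:R * q) *: f).
Proof.
rewrite !scale1r !mul1r -!scalerA !scaler_nat.
set E := e *+ 2 + mu *: f; set Q := q *: f.
have -> : - (d - E + Q) - Q + (e - Q) *+ 2 + mu *: f = - (d - E + Q) - Q + (E - Q *+ 2).
  by rewrite /E mulrnBl -!addrA [- _ + mu *: f]addrC.
clearbody E Q; rewrite !mulr2n !opprD !opprK -!addrA; congr (- d + _).
by congr (_ + _); rewrite [in LHS](addrCA (- Q) E) addrCA.
Qed.

Lemma scaled_gaussian_terms (a q mu : K) (d e f : V) :
  - (a *: (d - 1 *: (2%:R *: e + mu *: f) + (1 * 1 * q) *: f)) - q *: (a *: f) +
    2%:R *: (a *: (e - q *: f)) + mu *: (a *: f) =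
  a *: (- (d - 2%:R *: (2%:R *: e + mu *: f) + (2%:R * 2%:R * q) *: f)).
Proof.
have swap b (y : V) : b *: (a *: y) = a *: (b *: y) by rewrite !scalerA mulrC.
rewrite -gaussian_terms.
move: (d - 1 *: _ + _) (e - q *: f) => y z.
by rewrite (swap q) (swap 2%:R z) (swap mu) [RHS]scalerDr !(scalerDr a) !scalerN.
Qed.

End ModuleIdentities.

(** * Product rules for the divided differences *)

Section DividedDifference.
Variables (R : realType) (m : nat).
Local Notation vec := 'rV[R]_m.
Local Notation C := R[i].
Local Notation Cl := (Cl R m).
Local Notation clfun := (clfun R m).
Implicit Types (F G : clfun) (a u v x : vec).

Lemma dquot_cst a (c : Cl) x : dquot a (fun=> c) x = 0.
Proof. by rewrite /dquot ddir_cst subrr scaler0 if_same. Qed.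

Lemma dquotD a F G x : derivable_cl F -> derivable_cl G ->
  dquot a (fun y => F y + G y) x = dquot a F x + dquot a G x.
Proof.
move=> dF dG; rewrite /dquot (ddirD a x dF dG); case: eqVneq => [_|_]; first reflexivity.
by rewrite -scalerDr opprD addrACA.
Qed.

(** Off the hyperplane this rests on <u,x> - <u,r_a x> = <a,x><a,u>; on it, on the Leibniz rule for
    the derivative along a, together with r_a x = x. *)
Lemma dquot_dotp a u F x : dotp a a = 2 -> derivable_cl F ->
  dquot a (rmul (dotp u) F) x =
    (dotp u x)%:C *: dquot a F x + (dotp a u)%:C *: F (refl a x).
Proof.
move=> a2 dF; rewrite /dquot; case: eqVneq => [ax0|ax0].
  by rewrite (ddir_rmul (is_derive_dotp u x a) dF) refl_fix // addrC (dotpC a u).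
have -> : dotp a u = (dotp a x)^-1 * (dotp u x - dotp u (refl a x)).
  by rewrite refl2E // dotpBr dotpZr opprB addrCA subrr addr0 mulKf // dotpC.
rewrite /rmul; move: (refl a x) => y.
by apply/ffunP => A; rewrite !ffunE /GRing.scale /= !(rmorphM, rmorphB); ring.
Qed.

(** The derivative of g is constrained only on the hyperplane, the one place where [dquot] is a
    derivative. For a Gaussian it is a multiple of <a,x> and vanishes there. *)
Lemma dquot_invariant a (g : vec -> R) F x : (forall y, g (refl a y) = g y) ->
  (dotp a x = 0 -> is_derive x a g 0) -> derivable_cl F ->
  dquot a (rmul g F) x = (g x)%:C *: dquot a F x.
Proof.
move=> ga g' dF; rewrite /dquot; case: eqVneq => [ax0|ax0].
  by rewrite (ddir_rmul (g' ax0) dF) scale0r add0r.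
by rewrite /rmul ga -scalerBr !scalerA mulrC.
Qed.

End DividedDifference.

(** * Dunkl operators in arbitrary directions on polynomials *)

Section DunklOperators.
Variables (R : realType) (m : nat) (Rs Rp : seq 'rV[R]_m) (kappa : 'rV[R]_m -> R[i]).
Local Notation vec := 'rV[R]_m.
Local Notation C := R[i].
Local Notation Cl := (Cl R m).
Local Notation clfun := (clfun R m).
Implicit Types (F G : clfun) (a u v x : vec).

Hypothesis Rp2 : forall a, a \in Rp -> dotp a a = 2.

(* [locked] keeps unification from unfolding the definition. *)
Definition dunkl_dir v F : clfun := locked (fun x =>
  ddir v F x + \sum_(a <- Rp) (kappa a * (dotp a v)%:C) *: dquot a F x).

Lemma dunkl_dirE v F x : dunkl_dir v F x =
  ddir v F x + \sum_(a <- Rp) (kappa a * (dotp a v)%:C) *: dquot a F x.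
Proof. by rewrite /dunkl_dir -lock. Qed.

Lemma dunklE i F : dunkl Rp kappa i F = dunkl_dir (unitv R i) F.
Proof.
apply/funext => x; rewrite /dunkl dunkl_dirE; apply: (congr1 (+%R _)).
by apply: eq_bigr => a _; rewrite dotpC dotp_unitv.
Qed.

Lemma dunkl_dir_cst v (c : Cl) : dunkl_dir v (fun=> c) = fun=> 0.
Proof.
apply/funext => x; rewrite dunkl_dirE ddir_cst big1 ?addr0 // => a _.
by rewrite dquot_cst scaler0.
Qed.

Lemma dunkl_dirD v F G : clpoly F -> clpoly G ->
  dunkl_dir v (fun x => F x + G x) = fun x => dunkl_dir v F x + dunkl_dir v G x.
Proof.
move=> /clpoly_derivable dF /clpoly_derivable dG; apply/funext => x.
rewrite !dunkl_dirE (ddirD v x dF dG) addrACA; congr (_ + _).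
by rewrite -big_split; apply: eq_bigr => a _; rewrite (dquotD a x dF dG) scalerDr.
Qed.

(** Besides the Leibniz terms, each positive root leaves the value at the reflected point produced
    by [dquot_dotp]. *)
Lemma dunkl_dir_dotp v u F : clpoly F ->
  dunkl_dir v (rmul (dotp u) F) = fun x => (dotp u x)%:C *: dunkl_dir v F x +
    (dotp u v)%:C *: F x +
    \sum_(a <- Rp) (kappa a * (dotp a v * dotp a u)%:C) *: F (refl a x).
Proof.
move=> /clpoly_derivable dF; apply/funext => x.
rewrite !dunkl_dirE (ddir_rmul (is_derive_dotp u x v) dF).
rewrite scalerDr scaler_sumr -!addrA addrCA; congr (_ + _).
rewrite [RHS]addrCA; congr (_ + _).
rewrite -big_split; apply: eq_big_seq => a aR /=.
rewrite dquot_dotp ?Rp2 // scalerDr !scalerA rmorphM mulrA.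
have -> : kappa a * (dotp a v)%:C * (dotp u x)%:C =
  (dotp u x)%:C * (kappa a * (dotp a v)%:C) by ring.
by rewrite -!mulrA.
Qed.

Definition shifted_dunkl (c : R) v F : clfun := fun x =>
  dunkl_dir v F x - c%:C *: rmul (dotp v) F x.

(** Divided differences let the invariant factor g pass, so only the derivative of g leaves an extra
    term, -c <v,x>. *)
Lemma dunkl_dir_gaussian (c : R) (g : vec -> R) v F :
  (forall x w, is_derive x w g (- (c * dotp w x) * g x)) ->
  (forall a y, a \in Rp -> g (refl a y) = g y) ->
  clpoly F -> dunkl_dir v (rmul g F) = rmul g (shifted_dunkl c v F).
Proof.
move=> g' g_inv /clpoly_derivable dF; apply/funext => x.
rewrite [RHS]/rmul /shifted_dunkl !dunkl_dirE (ddir_rmul (g' x v) dF).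
rewrite [rmul _ _ x]/rmul [RHS]scalerBr [in RHS]scalerDr !scalerA.
have -> : (- (c * dotp v x) * g x)%:C = - ((g x)%:C * (c%:C * (dotp v x)%:C)).
  by rewrite !(rmorphM, rmorphN); ring.
rewrite scaleNr -addrA addrC; apply: (congr1 (+%R ^~ _)); apply: (congr1 (+%R _)).
rewrite scaler_sumr; apply: eq_big_seq => a aR.
have g0 : dotp a x = 0 -> is_derive x a g 0.
  by move=> ax0; have := g' x a; rewrite ax0 mulr0 oppr0 mul0r.
by rewrite (dquot_invariant (fun y => g_inv a y aR) g0 dF) !scalerA mulrC.
Qed.

(** Summing x_i a_i gives <a,x>, which cancels the denominator of the divided difference; on the
    hyperplane both sides of this cancellation are zero because r_a x = x. *)
Lemma sum_dunkl_euler F x : \sum_i (x 0 i)%:C *: dunkl_dir (unitv R i) F x =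
  euler F x + \sum_(a <- Rp) kappa a *: (F x - F (refl a x)).
Proof.
rewrite /euler /partial.
under eq_bigr => i _ do rewrite dunkl_dirE scalerDr.
rewrite big_split; apply: (congr1 (+%R _)).
under eq_bigr do rewrite scaler_sumr.
rewrite exchange_big; apply: eq_bigr => a _ /=.
transitivity ((kappa a * (dotp a x)%:C) *: dquot a F x).
  rewrite /dotp rmorph_sum mulr_sumr scaler_suml; apply: eq_bigr => i _.
  rewrite -/(dotp a (unitv R i)) dotpC dotp_unitv scalerA rmorphM mulrCA.
  by rewrite [_%:C * _%:C]mulrC.
rewrite -scalerA; apply: (congr1 ( *:%R _)).
rewrite /dquot; case: eqVneq => [ax0|ax0].
  by rewrite ax0 scale0r refl_fix // subrr.
by rewrite scalerA -rmorphM divff // scale1r.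
Qed.

(** The product rule replaces a division of polynomials by <a,x>: its right side uses only
    operations that preserve [clpoly]. *)
Lemma clpoly_dunkl_dir v F : clpoly F -> clpoly (dunkl_dir v F).
Proof.
elim=> [c|{}F G pF pTF pG pTG|u {}F pF pTF].
- by rewrite dunkl_dir_cst; exact: clpoly_cst.
- by rewrite (dunkl_dirD v pF pG); exact: clpolyD.
- rewrite (dunkl_dir_dotp v u pF); apply: clpolyD.
    by apply: clpolyD; [exact: clpoly_dotp|exact: clpolyZ].
  by apply: clpoly_sum => a /Rp2 a2; apply/clpolyZ/(clpoly_refl a2).
Qed.

Lemma dunkl_dir_map (M : Cl -> Cl) v F : {morph M : u v / u + v} ->
  (forall c, {morph M : u / c *: u}) -> clpoly F ->
  dunkl_dir v (fun x => M (F x)) = fun x => M (dunkl_dir v F x).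
Proof.
move=> MD MZ.
have M0 : M 0 = 0 by rewrite -[X in M X](scale0r 0) MZ scale0r.
elim=> [c|{}F G pF IHF pG IHG|u {}F pF IHF].
- by rewrite !dunkl_dir_cst M0.
- rewrite (_ : (fun x => M (F x + G x)) = fun x => M (F x) + M (G x)).
    rewrite (dunkl_dirD v pF pG) (dunkl_dirD v (clpoly_map MD MZ pF) (clpoly_map MD MZ pG)).
    by rewrite IHF IHG; apply/funext => x; rewrite MD.
  by apply/funext => x; rewrite MD.
- rewrite (_ : (fun x => M (rmul (dotp u) F x)) = rmul (dotp u) (fun x => M (F x))).
    rewrite (dunkl_dir_dotp v u pF) (dunkl_dir_dotp v u (clpoly_map MD MZ pF)) IHF.
    apply/funext => x; rewrite !(MD, MZ).
    apply: (congr1 (+%R _)); rewrite (big_morph M MD M0).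
    by apply: eq_bigr => a _; rewrite MZ.
  by apply/funext => x; rewrite /rmul MZ.
Qed.

Lemma dunkl_dirZ v (c : C) F : clpoly F ->
  dunkl_dir v (fun x => c *: F x) = fun x => c *: dunkl_dir v F x.
Proof.
apply: dunkl_dir_map => [w z|b w]; first exact: scalerDr.
by rewrite !scalerA mulrC.
Qed.

Lemma dunkl_dir_sum v (I : eqType) (s : seq I) (F : I -> clfun) :
  (forall i, i \in s -> clpoly (F i)) -> dunkl_dir v (fun x => \sum_(i <- s) F i x) =
  fun x => \sum_(i <- s) dunkl_dir v (F i) x.
Proof.
elim: s => [|i s IHs] pF.
  rewrite (_ : (fun _ => _) = fun=> 0); last by apply/funext => x; rewrite big_nil.
  by rewrite dunkl_dir_cst; apply/funext => x; rewrite big_nil.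
rewrite (_ : (fun _ => _) = fun x => F i x + \sum_(j <- s) F j x); last first.
  by apply/funext => x; rewrite big_cons.
have pi : clpoly (F i) by apply: pF; rewrite mem_head.
have ps j : j \in s -> clpoly (F j) by move=> js; apply: pF; rewrite in_cons js orbT.
rewrite (dunkl_dirD v pi (clpoly_sum ps)) (IHs ps).
by apply/funext => x; rewrite big_cons.
Qed.

(** Linearity in the direction comes from the product rule by induction on F; it serves to expand T
    in a reflected direction. *)
Lemma dunkl_dir_linear (v w : vec) (c : R) F x : clpoly F ->
  dunkl_dir (v + c *: w) F x = dunkl_dir v F x + c%:C *: dunkl_dir w F x.
Proof.
move=> pF; elim: pF x => [b|{}F G pF IHF pG IHG|u {}F pF IHF] x.
- by rewrite !dunkl_dir_cst scaler0 addr0.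
- rewrite (dunkl_dirD (v + c *: w) pF pG) (dunkl_dirD v pF pG) (dunkl_dirD w pF pG).
  by rewrite IHF IHG; exact: addr_scaleACA.
- rewrite (dunkl_dir_dotp (v + c *: w) u pF) (dunkl_dir_dotp v u pF).
  rewrite (dunkl_dir_dotp w u pF) IHF dotpDr dotpZr (rmorphD _ (dotp u v)) rmorphM.
  rewrite -leibniz_linear; apply: (congr1 (+%R _)).
  rewrite scaler_sumr -big_split; apply: eq_bigr => a _ /=.
  rewrite scalerA -scalerDl dotpDr dotpZr.
  by apply: (congr1 ( *:%R ^~ _)); rewrite !(rmorphM, rmorphD); ring.
Qed.

End DunklOperators.

(** * Equivariance and commutation of the Dunkl operators *)

Section Commutation.
Variables (R : realType) (m : nat) (Rs Rp : seq 'rV[R]_m) (kappa : 'rV[R]_m -> R[i]).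
Local Notation vec := 'rV[R]_m.
Local Notation C := R[i].
Local Notation Cl := (Cl R m).
Local Notation clfun := (clfun R m).
Implicit Types (F G : clfun) (a b u v x : vec).

Hypotheses (Rs_root : root_system Rs) (Rs2 : normalized Rs).
Hypotheses (Rp_pos : positive_subsystem Rs Rp) (kappa_inv : G_invariant Rs kappa).

Local Notation dunkl_dir := (dunkl_dir Rp kappa).

Lemma positive_root a : a \in Rp -> a \in Rs.
Proof. by case: Rp_pos => _ [beta [_ Rp_iff]] /Rp_iff []. Qed.

Lemma positive_root2 a : a \in Rp -> dotp a a = 2.
Proof. by move/positive_root/Rs2. Qed.

Lemma root_refl a b : a \in Rs -> b \in Rs -> refl b a \in Rs.
Proof. by case: Rs_root => _ _ Rs_refl _ aR bR; exact: Rs_refl. Qed.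

Lemma root_opp a : a \in Rs -> - a \in Rs.
Proof. by move=> aR; rewrite -refl_self ?Rs2 //; exact: root_refl. Qed.

Lemma kappa_refl a b : a \in Rs -> b \in Rs -> kappa (refl b a) = kappa a.
Proof. by move=> aR bR; apply: (kappa_inv (s := [:: b])) => //=; rewrite bR. Qed.

Lemma kappa_opp a : a \in Rs -> kappa (- a) = kappa a.
Proof. by move=> aR; rewrite -refl_self ?Rs2 // kappa_refl. Qed.

(** The functional beta vanishes on no root, so exactly one of a and -a is positive. *)
Lemma perm_roots : perm_eq Rs (Rp ++ map -%R Rp).
Proof.
case: Rs_root => Rs_uniq _ _ _; case: Rp_pos => Rp_uniq [beta [beta_reg Rp_iff]].
apply: uniq_perm => //.
  rewrite cat_uniq Rp_uniq map_inj_uniq ?Rp_uniq ?andbT /=; last exact: oppr_inj.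
  apply/hasPn => _ /mapP [a /Rp_iff [_ a_pos] ->]; apply/negP => /Rp_iff [_].
  by rewrite dotpNr oppr_gt0 ltNge (ltW a_pos).
move=> a; rewrite mem_cat; apply/idP/orP => [aR|[/Rp_iff []//|]]; last first.
  by case/mapP => b /Rp_iff [bR _] ->; exact: root_opp.
have := beta_reg a aR; case: ltgtP => // a_sgn _; last by left; apply/Rp_iff.
right; apply/mapP; exists (- a); last by rewrite opprK.
by apply/Rp_iff; rewrite root_opp // dotpNr oppr_gt0.
Qed.

(** The reflection r_b permutes all roots but in general not the positive ones. For even f the sum
    over [Rp] is half the sum over [Rs], which is invariant. *)
Lemma sum_positive_refl (f : vec -> Cl) b : b \in Rs ->
  (forall a, a \in Rs -> f (- a) = f a) ->
  \sum_(a <- Rp) f (refl b a) = \sum_(a <- Rp) f a.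
Proof.
move=> bR f_even.
have double (h : vec -> Cl) : (forall a, a \in Rs -> h (- a) = h a) ->
    (2%:R : C) *: \sum_(a <- Rp) h a = \sum_(a <- Rs) h a.
  move=> h_even; rewrite (perm_big _ perm_roots) big_cat big_map /=.
  rewrite scaler_nat mulr2n; apply: (congr1 (+%R _)).
  by apply: eq_big_seq => a /positive_root /h_even.
have two_neq0 : (2%:R : C) != 0 by rewrite pnatr_eq0.
apply: (scalerI two_neq0); rewrite !double //; last first.
  by move=> a aR; rewrite refl_oppr ?Rs2 // f_even // root_refl.
rewrite -(big_map (refl b) xpredT f); apply: perm_big; apply: uniq_perm.
- rewrite map_inj_uniq; first by case: Rs_root.
  exact: inv_inj (reflK (Rs2 bR)).
- by case: Rs_root.
- move=> a; apply/mapP/idP => [[c cR ->]|aR]; first exact: root_refl.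
  by exists (refl b a); rewrite ?reflK ?Rs2 // root_refl.
Qed.

(** By induction on F. The reflection terms of the product rule match after reindexing the roots by
    r_b, using the invariance of kappa and r_a r_b = r_b r_(r_b a). *)
Lemma dunkl_dir_refl b v F x : b \in Rs -> clpoly F ->
  dunkl_dir v F (refl b x) = dunkl_dir (refl b v) (F \o refl b) x.
Proof.
move=> bR pF; have b2 := Rs2 bR; have Rp2 := positive_root2.
elim: pF x => [c|{}F G pF IHF pG IHG|u {}F pF IHF] x.
- have -> : (fun=> c) \o refl b = (fun=> c) :> clfun by [].
  by rewrite !dunkl_dir_cst.
- have pFb := clpoly_refl b2 pF; have pGb := clpoly_refl b2 pG.
  have -> : (fun y => F y + G y) \o refl b = fun y => (F \o refl b) y + (G \o refl b) y.
    by [].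
  by rewrite (dunkl_dirD _ _ v pF pG) (dunkl_dirD _ _ (refl b v) pFb pGb) IHF IHG.
- have pFb := clpoly_refl b2 pF.
  have -> : rmul (dotp u) F \o refl b = rmul (dotp (refl b u)) (F \o refl b).
    by apply/funext => y; rewrite /rmul /= dotp_refl.
  rewrite (dunkl_dir_dotp kappa Rp2 v u pF).
  rewrite (dunkl_dir_dotp kappa Rp2 (refl b v) (refl b u) pFb).
  rewrite IHF (refl_isom u v b2) (dotp_refl u x b2); apply: (congr1 (+%R _)).
  (* The summand is even in a, as reindexing a sum over positive roots requires. *)
  pose f a := (kappa a * (dotp a (refl b v) * dotp a (refl b u))%:C) *: F (refl b (refl a x)).
  have f_even a : a \in Rs -> f (- a) = f a.
    by move=> aR; rewrite /f (kappa_opp aR) !dotpNl mulrNN refl_Nroot.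
  rewrite -[RHS](sum_positive_refl bR f_even).
  apply: eq_big_seq => a /positive_root aR.
  by rewrite /f (kappa_refl aR bR) !(refl_isom _ _ b2) -(refl_conj x (Rs2 aR) b2).
Qed.

(** Equivariance with r_b v = v - <b,v> b expanded, so that only operators evaluated at x remain. *)
Lemma dunkl_dir_at_refl b v F x : b \in Rs -> clpoly F ->
  dunkl_dir v F (refl b x) =
    dunkl_dir v (F \o refl b) x - (dotp b v)%:C *: dunkl_dir b (F \o refl b) x.
Proof.
move=> bR pF; have b2 := Rs2 bR; rewrite (dunkl_dir_refl v x bR pF) (refl2E v b2) -scaleNr.
rewrite (dunkl_dir_linear _ positive_root2 _ _ _ _ (clpoly_refl b2 pF)).
by rewrite rmorphN scaleNr.
Qed.

(** Apart from T_v T_w F, the right side is symmetric in v and w, so commutation passes from F to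
    <u,x> F. *)
Lemma dunkl_dir2_dotp v w u F x : clpoly F ->
  dunkl_dir v (dunkl_dir w (rmul (dotp u) F)) x =
    (dotp u x)%:C *: dunkl_dir v (dunkl_dir w F) x +
    ((dotp u v)%:C *: dunkl_dir w F x + (dotp u w)%:C *: dunkl_dir v F x) +
    \sum_(a <- Rp) (kappa a * (dotp a u)%:C) *:
      ((dotp a v)%:C *: dunkl_dir w (F \o refl a) x +
       (dotp a w)%:C *: dunkl_dir v (F \o refl a) x -
       (dotp a v * dotp a w)%:C *: dunkl_dir a (F \o refl a) x).
Proof.
move=> pF; have Rp2 := positive_root2.
have pT := clpoly_dunkl_dir kappa Rp2 w pF.
have pR a : a \in Rp -> clpoly (F \o refl a) by move=> aR; exact: clpoly_refl (Rp2 a aR) pF.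
have pS a : a \in Rp ->
    clpoly (fun x => (kappa a * (dotp a w * dotp a u)%:C) *: F (refl a x)).
  by move=> /pR; exact: clpolyZ.
rewrite (dunkl_dir_dotp kappa Rp2 w u pF).
rewrite (dunkl_dirD _ _ _ (clpolyD (clpoly_dotp u pT) (clpolyZ _ pF)) (clpoly_sum pS)).
rewrite (dunkl_dirD _ _ _ (clpoly_dotp u pT) (clpolyZ _ pF)).
rewrite (dunkl_dir_dotp kappa Rp2 v u pT) (dunkl_dirZ kappa Rp2 v _ pF).
rewrite (dunkl_dir_sum _ _ v pS).
have regroup (y p q s t r : Cl) : s + t = r -> y + p + s + q + t = y + (p + q) + r.
  by move=> <-; rewrite -!addrA; congr (_ + (_ + _)); rewrite addrCA.
apply: regroup; rewrite -big_split; apply: eq_big_seq => a aR /=.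
rewrite (dunkl_dir_at_refl w x (positive_root aR) pF).
rewrite (dunkl_dirZ kappa Rp2 v _ (pR a aR)).
by rewrite !rmorphM; exact: commutator_terms.
Qed.

Lemma dunkl_dirC v w F x : clpoly F ->
  dunkl_dir v (dunkl_dir w F) x = dunkl_dir w (dunkl_dir v F) x.
Proof.
move=> pF; elim: pF x => [c|{}F G pF IHF pG IHG|u {}F pF IHF] x.
- by rewrite !dunkl_dir_cst.
- have Rp2 := positive_root2.
  rewrite (dunkl_dirD _ _ v pF pG) (dunkl_dirD _ _ w pF pG).
  have pT u G' := @clpoly_dunkl_dir _ _ _ kappa Rp2 u G'.
  rewrite (dunkl_dirD _ _ v (pT w F pF) (pT w G pG)).
  rewrite (dunkl_dirD _ _ w (pT v F pF) (pT v G pG)).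
  exact: (congr2 +%R (IHF x) (IHG x)).
- rewrite (dunkl_dir2_dotp v w u x pF) (dunkl_dir2_dotp w v u x pF) (IHF x).
  have swap (y p q s r : Cl) : s = r -> y + (p + q) + s = y + (q + p) + r.
    by move=> ->; rewrite [p + q]addrC.
  apply: swap; apply: eq_bigr => a _; rewrite [dotp a v * _]mulrC.
  apply: (congr1 ( *:%R _)); apply: (congr1 (+%R ^~ _)); exact: addrC.
Qed.

End Commutation.

(** * The shifted operators, the square of D_+, and conjugation by Gaussians *)

Section ShiftedDunkl.
Variables (R : realType) (m : nat) (Rs Rp : seq 'rV[R]_m) (kappa : 'rV[R]_m -> R[i]).
Local Notation vec := 'rV[R]_m.
Local Notation C := R[i].
Local Notation Cl := (Cl R m).
Local Notation clfun := (clfun R m).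
Implicit Types (F G : clfun) (a b u v x : vec).

Hypotheses (Rs_root : root_system Rs) (Rs2 : normalized Rs).
Hypotheses (Rp_pos : positive_subsystem Rs Rp) (kappa_inv : G_invariant Rs kappa).

Local Notation dunkl_dir := (dunkl_dir Rp kappa).
Local Notation shifted_dunkl := (shifted_dunkl Rp kappa).

Let Rp2 : forall a, a \in Rp -> dotp a a = 2 := positive_root2 Rs2 Rp_pos.

Lemma shifted_dunklE (c : R) v F :
  shifted_dunkl c v F = fun x => dunkl_dir v F x + (- c%:C) *: rmul (dotp v) F x.
Proof. by apply/funext => x; rewrite /shifted_dunkl scaleNr. Qed.

Lemma clpoly_shifted (c : R) v F : clpoly F -> clpoly (shifted_dunkl c v F).
Proof.
move=> pF; rewrite shifted_dunklE.
exact: clpolyD (clpoly_dunkl_dir kappa Rp2 v pF) (clpolyZ _ (clpoly_dotp v pF)).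
Qed.

Lemma shifted_map (M : Cl -> Cl) (c : R) v F : {morph M : u v / u + v} ->
  (forall k, {morph M : u / k *: u}) -> clpoly F ->
  shifted_dunkl c v (fun x => M (F x)) = fun x => M (shifted_dunkl c v F x).
Proof.
move=> MD MZ pF; rewrite !shifted_dunklE (dunkl_dir_map kappa Rp2 v MD MZ pF).
by apply/funext => x; rewrite /rmul MD !MZ.
Qed.

Lemma shifted_sum (c : R) v (I : eqType) (s : seq I) (F : I -> clfun) :
  (forall i, clpoly (F i)) -> shifted_dunkl c v (fun x => \sum_(i <- s) F i x) =
  fun x => \sum_(i <- s) shifted_dunkl c v (F i) x.
Proof.
move=> pF; rewrite shifted_dunklE (dunkl_dir_sum _ _ v (fun i _ => pF i)).
apply/funext => x; rewrite /shifted_dunkl /rmul !scaler_sumr -big_split.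
by apply: eq_bigr => i _; rewrite scaleNr.
Qed.

(** Apart from T_v T_w F, every term is symmetric in v and w; the same expansion is later summed
    over the basis. *)
Lemma shifted_dunkl2 (c : R) v w F x : clpoly F ->
  shifted_dunkl c v (shifted_dunkl c w F) x =
    dunkl_dir v (dunkl_dir w F) x -
    c%:C *: ((dotp w x)%:C *: dunkl_dir v F x + (dotp v x)%:C *: dunkl_dir w F x +
      ((dotp w v)%:C *: F x +
       \sum_(a <- Rp) (kappa a * (dotp a v * dotp a w)%:C) *: F (refl a x))) +
    (c%:C * c%:C * ((dotp v x)%:C * (dotp w x)%:C)) *: F x.
Proof.
move=> pF; rewrite -shifted_terms {1}/shifted_dunkl.
apply: (congr2 (fun y z => y - z)); last reflexivity.
rewrite shifted_dunklE (dunkl_dirD _ _ v (clpoly_dunkl_dir kappa Rp2 w pF)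
  (clpolyZ _ (clpoly_dotp w pF))).
rewrite (dunkl_dirZ kappa Rp2 v _ (clpoly_dotp w pF)).
by rewrite (dunkl_dir_dotp kappa Rp2 v w pF) scaleNr.
Qed.

Lemma shifted_dunklC (c : R) v w F x : clpoly F ->
  shifted_dunkl c v (shifted_dunkl c w F) x =
  shifted_dunkl c w (shifted_dunkl c v F) x.
Proof.
move=> pF; rewrite (shifted_dunkl2 c v w x pF) (shifted_dunkl2 c w v x pF).
rewrite (dunkl_dirC Rs_root Rs2 Rp_pos kappa_inv v w x pF) (dotpC w v).
have -> : (dotp v x)%:C * (dotp w x)%:C = (dotp w x)%:C * (dotp v x)%:C by exact: mulrC.
apply: (congr1 (+%R ^~ _)); apply: (congr1 (fun y => _ - _ *: y)).
apply: (congr2 +%R); first exact: addrC.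
by apply: (congr1 (+%R _)); apply: eq_bigr => a _; rewrite (mulrC (dotp a v)).
Qed.

(** On polynomials this is -Delta - 4|x|^2 + 2(2E + mu), the operator to which all three expressions
    of the Rodrigues formula reduce. *)
Definition hermite_op F : clfun := fun x =>
  - \sum_i shifted_dunkl 2 (unitv R i) (shifted_dunkl 2 (unitv R i) F) x.

Lemma clpoly_hermite_op F : clpoly F -> clpoly (hermite_op F).
Proof.
move=> pF; apply: (@clpoly_map R m (fun z => - z)) => [u v|c u|].
- exact: opprD.
- by rewrite scalerN.
- by apply: clpoly_sum => i _; do 2!apply: clpoly_shifted.
Qed.

Lemma DplusE F x : Dplus Rp kappa F x =
  - \sum_i clmul (cle R i) (shifted_dunkl 2 (unitv R i) F x).
Proof.
rewrite /Dplus /dunkl_dirac /xmul scaler_sumr -!sumrN -big_split.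
apply: eq_bigr => i _; rewrite shifted_dunklE dunklE clmul_cleD clmul_cleZ /rmul.
by rewrite dotp_unitv clmul_cleZ scaleNr opprB addrC rmorph_nat.
Qed.

Lemma Dplus_Dplus F : clpoly F -> Dplus Rp kappa (Dplus Rp kappa F) = hermite_op F.
Proof.
move=> pF; apply/funext => x; rewrite DplusE /hermite_op.
pose S i F := shifted_dunkl 2 (unitv R i) F.
have pS i : clpoly (S i F) by exact: clpoly_shifted.
have pM i : clpoly (fun y => clmul (cle R i) (S i F y)).
  exact: clpoly_map (@clmul_cleD R m i) (@clmul_cleZ R m i) (pS i).
have M0 (i : 'I_m) : clmul (cle R i) 0 = 0.
  by rewrite -[X in clmul _ X](scale0r 0) clmul_cleZ scale0r.
have -> : Dplus Rp kappa F = fun y => - \sum_j clmul (cle R j) (S j F y).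
  by apply/funext => y; rewrite DplusE.
(* The sum of squares is traded for the full double sum of e_i e_j S_i S_j F, which is allowed
   because the S_i commute. *)
rewrite -(clmul_cle_sum2 (w := fun i j => S i (S j F) x)); last first.
  by move=> i j; exact: shifted_dunklC.
rewrite -sumrN; apply: eq_bigr => i _.
rewrite (@shifted_map (fun z => - z)); first last.
- by apply: clpoly_sum => j _; exact: pM.
- by move=> c u; rewrite scalerN.
- exact: opprD.
rewrite (shifted_sum _ _ _ pM) -[X in clmul _ X]scaleN1r clmul_cleZ scaleN1r opprK.
rewrite (big_morph _ (@clmul_cleD R m i) (M0 i)); apply: eq_bigr => j _.
by rewrite (shifted_map _ _ (@clmul_cleD R m j) (@clmul_cleZ R m j) (pS j)).
Qed.

(** The two properties of exp(-c|x|^2/2) on which conjugation rests; the exponential itself enters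
    only at the end. *)
Definition gaussian (c : R) (g : vec -> R) :=
  (forall x w, is_derive x w g (- (c * dotp w x) * g x)) /\
  (forall a x, dotp a a = 2 -> g (refl a x) = g x).

Lemma dunkl_lap_gaussian (c : R) (g : vec -> R) F x : gaussian c g -> clpoly F ->
  dunkl_lap Rp kappa (rmul g F) x =
  (g x)%:C *: \sum_i shifted_dunkl c (unitv R i) (shifted_dunkl c (unitv R i) F) x.
Proof.
move=> [g' g_inv] pF; rewrite scaler_sumr; apply: eq_bigr => i _.
have g_Rp a y : a \in Rp -> g (refl a y) = g y by move/Rp2; exact: g_inv.
rewrite !dunklE (dunkl_dir_gaussian kappa (unitv R i) g' g_Rp pF).
by rewrite (dunkl_dir_gaussian kappa (unitv R i) g' g_Rp (clpoly_shifted c _ pF)).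
Qed.

Lemma euler_gaussian (c : R) (g : vec -> R) F x : gaussian c g -> clpoly F ->
  euler (rmul g F) x = (g x)%:C *: (euler F x - (c * sqnorm x)%:C *: F x).
Proof.
move=> [g' _] /clpoly_derivable dF; rewrite /euler /partial /sqnorm.
rewrite [c * _]mulr_sumr rmorph_sum scaler_suml -sumrB scaler_sumr.
apply: eq_bigr => i _; rewrite (ddir_rmul (g' x (unitv R i)) dF) dotp_unitv.
rewrite scalerBr scalerDr !scalerA addrC -scaleNr.
apply: (congr2 +%R); apply: (congr1 ( *:%R ^~ _)); first exact: mulrC.
by rewrite !(rmorphM, rmorphN); ring.
Qed.

(** The cross terms give twice E F + gamma F - sum_a kappa_a F(r_a x), and the product rule gives m
    F + 2 sum_a kappa_a F(r_a x), the 2 being |a|^2. The reflected values cancel, and m + 2 gamma =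
    mu remains. *)
Lemma sum_shifted_dunkl2 (c : R) F x : clpoly F ->
  \sum_i shifted_dunkl c (unitv R i) (shifted_dunkl c (unitv R i) F) x =
    dunkl_lap Rp kappa F x - c%:C *: (2%:R *: euler F x + mu Rp kappa *: F x) +
    (c%:C * c%:C * (sqnorm x)%:C) *: F x.
Proof.
move=> pF; under eq_bigr => i _ do rewrite (shifted_dunkl2 c _ _ x pF).
rewrite !big_split /=; apply: (congr2 +%R); last first.
  rewrite -scaler_suml -mulr_sumr rmorph_sum; apply: (congr1 (fun y => (_ * y) *: _)).
  by apply: eq_bigr => i _; rewrite dotp_unitv rmorphM.
apply: (congr2 +%R); first by rewrite /dunkl_lap; apply: eq_bigr => i _; rewrite !dunklE.
rewrite sumrN -scaler_sumr; apply: (congr1 (fun y => - (_ *: y))).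
rewrite !big_split /=.
have -> : \sum_(i < m) (dotp (unitv R i) x)%:C *: dunkl_dir (unitv R i) F x =
    euler F x + \sum_(a <- Rp) kappa a *: (F x - F (refl a x)).
  by rewrite -sum_dunkl_euler; apply: eq_bigr => i _; rewrite dotp_unitv.
have -> : \sum_(i < m) (dotp (unitv R i) (unitv R i))%:C *: F x = (m%:R : C) *: F x.
  rewrite scaler_nat (eq_bigr (fun=> F x)) ?sumr_const ?card_ord // => i _.
  by rewrite dotp_unitv mxE !eqxx scale1r.
have -> : \sum_(i < m) \sum_(a <- Rp)
      (kappa a * (dotp a (unitv R i) * dotp a (unitv R i))%:C) *: F (refl a x) =
    2%:R *: \sum_(a <- Rp) kappa a *: F (refl a x).
  rewrite exchange_big scaler_sumr; apply: eq_big_seq => a /Rp2 a2.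
  rewrite -scaler_suml -mulr_sumr scalerA mulrC; apply: (congr1 (fun y => (y * _) *: _)).
  rewrite -rmorph_sum -(rmorph_nat (real_complex R)) -a2; apply: (congr1 (real_complex R)).
  by apply: eq_bigr => i _; rewrite dotpC dotp_unitv.
under eq_bigr => a _ do rewrite scalerBr.
have -> : \sum_(a <- Rp) (kappa a *: F x - kappa a *: F (refl a x)) =
    gamma Rp kappa *: F x - \sum_(a <- Rp) kappa a *: F (refl a x).
  by rewrite sumrB /gamma scaler_suml.
rewrite /mu.
move: (euler F x) (F x) (\sum_(a <- Rp) _ *: _) (gamma _ _) => y f s g.
exact: shifted_sum_terms.
Qed.


(** Conjugation by exp(-|x|^2/2) gives the shift c = 1 in the Laplacian; the remaining terms of
    [Lop] raise it to c = 2. *)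
Lemma Lop_gaussian (g : vec -> R) F : gaussian 1 g -> clpoly F ->
  Lop Rp kappa (rmul g F) = rmul g (hermite_op F).
Proof.
move=> gG pF; apply/funext => x.
have lapE := dunkl_lap_gaussian x gG pF.
rewrite (sum_shifted_dunkl2 1 x pF) rmorph1 in lapE.
have eulE := euler_gaussian x gG pF; rewrite mul1r in eulE.
rewrite /Lop lapE eulE [RHS]/rmul /hermite_op (sum_shifted_dunkl2 2 x pF).
by rewrite (rmorph_nat _ 2); exact: scaled_gaussian_terms.
Qed.

Lemma Nlap_gaussian (g : vec -> R) F : gaussian 2 g -> clpoly F ->
  (fun x => - dunkl_lap Rp kappa (rmul g F) x) = rmul g (hermite_op F).
Proof.
move=> gG pF; apply/funext => x.
by rewrite (dunkl_lap_gaussian x gG pF) /rmul /hermite_op scalerN.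
Qed.

Lemma clpoly_iter_hermite t F : clpoly F -> clpoly (iter t hermite_op F).
Proof. by move=> pF; elim: t => //= t; exact: clpoly_hermite_op. Qed.

Lemma iter_conj (L : clfun -> clfun) (g : vec -> R) t F :
  (forall G, clpoly G -> L (rmul g G) = rmul g (hermite_op G)) -> clpoly F ->
  iter t L (rmul g F) = rmul g (iter t hermite_op F).
Proof.
by move=> Lg pF; elim: t => //= t ->; apply: Lg; exact: clpoly_iter_hermite.
Qed.

End ShiftedDunkl.

(** * The exponential weights and the Rodrigues formula *)

Lemma gaussian_expR (R : realType) (m : nat) (c : R) (h : 'rV[R]_m -> R) :
  (forall x, h x = c / 2 * sqnorm x) -> gaussian c (fun x => expR (- h x)).
Proof.
move=> hE.
have -> : (fun x => expR (- h x)) = fun x => expR (- (c / 2 * sqnorm x)).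
  by apply/funext => x; rewrite hE.
split=> [x w|a x a2]; last by rewrite /sqnorm refl_isom.
apply: is_derive_eq; first exact: is_derive_gaussian.
by rewrite mulrCA divff ?mulr1 ?pnatr_eq0 // dotpC.
Qed.

Lemma rmul_expRK (R : realType) (m : nat) (h : 'rV[R]_m -> R) (F : clfun R m) :
  rmul (fun x => expR (h x)) (rmul (fun x => expR (- h x)) F) = F.
Proof.
apply/funext => x; rewrite /rmul scalerA -rmorphM expRN mulfV ?scale1r //.
by rewrite gt_eqF // expR_gt0.
Qed.

Unset Implicit Arguments.

Theorem theorem3p2 (R : realType) (m : nat) (Rs Rp : seq 'rV[R]_m)
    (kappa : 'rV[R]_m -> R[i]) (k t : nat) (H : 'rV[R]_m -> R) :
  root_system Rs -> normalized Rs -> positive_subsystem Rs Rp ->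
  G_invariant Rs kappa ->
  dunkl_harmonic Rp kappa k H ->
  (0 < t)%N ->
  clifford_hermite Rp kappa t H
    = rmul (fun x => expR (sqnorm x / 2))
        (iter t (Lop Rp kappa) (rmul (fun x => expR (- (sqnorm x / 2))) (of_real H)))
  /\
  rmul (fun x => expR (sqnorm x / 2))
        (iter t (Lop Rp kappa) (rmul (fun x => expR (- (sqnorm x / 2))) (of_real H)))
    = rmul (fun x => expR (sqnorm x))
        (iter t (fun F => fun x => - dunkl_lap Rp kappa F x)
           (rmul (fun x => expR (- sqnorm x)) (of_real H))).
Proof.
move=> Rs_root Rs2 Rp_pos kappa_inv [/hom_poly_clpoly pH _] _.
(* Both exponents have the form c|x|^2/2, with c = 1 and c = 2. *)
have g1 : gaussian 1 (fun x : 'rV[R]_m => expR (- (sqnorm x / 2))).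
  by apply: gaussian_expR => x; rewrite mul1r mulrC.
have g2 : gaussian 2 (fun x : 'rV[R]_m => expR (- sqnorm x)).
  by apply: gaussian_expR => x; rewrite divff ?mul1r // pnatr_eq0.
(* Both right-hand sides become the same iterate of [hermite_op] on H, the outer exponential
   cancelling the Gaussian. *)
have ->: rmul (fun x => expR (sqnorm x / 2))
    (iter t (Lop Rp kappa) (rmul (fun x => expR (- (sqnorm x / 2))) (of_real H))) =
    iter t (hermite_op Rp kappa) (of_real H).
  rewrite (iter_conj Rs2 Rp_pos t
    (fun F pF => Lop_gaussian kappa Rs2 Rp_pos g1 pF) pH).
  exact: rmul_expRK.
have -> : rmul (fun x => expR (sqnorm x))
    (iter t (fun F x => - dunkl_lap Rp kappa F x)
      (rmul (fun x => expR (- sqnorm x)) (of_real H))) =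
    iter t (hermite_op Rp kappa) (of_real H).
  rewrite (iter_conj Rs2 Rp_pos t
    (fun F pF => Nlap_gaussian kappa Rs2 Rp_pos g2 pF) pH).
  exact: rmul_expRK.
(* The 2t factors D_+ are grouped into t squares. *)
split=> //; rewrite /clifford_hermite -muln2 iterM.
elim: t => //= t ->.
apply: (Dplus_Dplus Rs_root Rs2 Rp_pos kappa_inv).
by apply: clpoly_iter_hermite pH; eassumption.
Qed.
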